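(* If $k\ge 2$ and $G$ is a chordal graph of order $n$ and chromatic number $\chi$, then $$\psi_k(G) \le \left(1- \frac{2}{\chi}\cdot \frac{k-1}{k}\right) n.$$ Moreover, this bound is tight for every $k$ with $\chi=2$ and also for every $\chi$ with $k=2$.
   Context: Graphs are simple and undirected, and $k$ is an integer. The order of $G$ is $n=|V(G)|$, and $\chi=\chi(G)$ is the chromatic number of $G$. A graph is chordal if it does not contain any induced cycle on more than three vertices. $P_k$ denotes the path of order $k$ (that is, with $k$ vertices). A $k$-path vertex cover of $G$ is a set $T\subseteq V(G)$ that shares at least one vertex with every path of order $k$ in $G$; i.e., $G-T$ does not contain any (not necessarily induced) $P_k$ subgraph. $\psi_k(G)$ denotes the minimum cardinality of a $k$-path vertex cover of $G$.
   Formalization: The case χ = 1 with k ≥ 3 (nonempty edgeless graphs) is excluded from the bound, since there ψ_k(G) = 0 while the right-hand side (2−k)n/k is negative. *)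

(* Defs.v *)
From mathcomp Require Import all_boot.

Set Implicit Arguments.
Unset Strict Implicit.
Unset Printing Implicit Defensive.

Record sgraph := SGraph {
  vertex :> finType;
  edge : rel vertex;
  edge_sym : symmetric edge;
  edge_irr : irreflexive edge
}.

Definition colorable (G : sgraph) (c : nat) : bool :=
  [exists f : {ffun G -> 'I_c},
     [forall x, forall y, edge x y ==> (f x != f y)]].

Lemma colorable_ex (G : sgraph) : exists c, colorable G c.
Proof.
exists #|G|; apply/existsP; exists [ffun x => enum_rank x].
apply/forallP=> x; apply/forallP=> y; apply/implyP=> exy.
rewrite !ffunE (inj_eq enum_rank_inj); apply: contraTneq exy => ->.
by rewrite edge_irr.
Qed.

Definition chi (G : sgraph) : nat := ex_minn (colorable_ex G).

Definition cycle_edge (m : nat) : rel 'I_m :=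
  fun i j => (j == i.+1 %[mod m]) || (i == j.+1 %[mod m]).

(* [f] identifies the cycle of order [m] with an induced subgraph of [G];
   this is meant for [m >= 3] only. *)
Definition induced_cycle (G : sgraph) (m : nat) (f : 'I_m -> G) : Prop :=
  injective f /\ forall i j, edge (f i) (f j) = cycle_edge i j.

Definition chordal (G : sgraph) : Prop :=
  forall m (f : 'I_m -> G), 3 < m -> ~ induced_cycle f.

(* A path of order [k] is given by the sequence of its [k] distinct vertices;
   chords are allowed. *)
Definition is_kpath (G : sgraph) (k : nat) (p : k.-tuple G) : bool :=
  uniq p && sorted (@edge G) p.

Definition kpath_cover (G : sgraph) (k : nat) (T : {set G}) : bool :=
  [forall p : k.-tuple G, is_kpath p ==> [exists x in T, x \in p]].

(* The default [setT] is itself a cover as soon as [k > 0]. *)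
Definition psi (k : nat) (G : sgraph) : nat :=
  #|[arg min_(T < [set: G] | kpath_cover k T) #|T| ]|.

(* Main.v *)
Require Import Defs.
From HB Require Import structures.
From mathcomp Require Import all_boot all_order all_algebra.
From mathcomp Require Import zify ring.

Set Implicit Arguments.
Unset Strict Implicit.
Unset Printing Implicit Defensive.

Import Order.TTheory GRing.Theory Num.Theory.
Local Open Scope ring_scope.

(** Two colour classes of a properly coloured graph span no triangle, while in
    a chordal graph every cycle has a triangle on its vertices, because a chord
    turns a longer cycle into a shorter one ([chordal_triangle]).  So in a
    chordal graph two colour classes induce a forest ([bicolored_acyclic]).

    A forest on a set [S] has a [k]-path cover of size at most [#|S| / k]
    ([acyclic_cover]).  In a rooted forest with a path of order [k], a deepest
    vertex [v] whose subtree [C] contains such a path meets all the paths of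
    order [k] of [C]; put [v] in the cover, delete [C], which has at least [k]
    vertices, and continue.  No root needs to be chosen: it is enough that [C]
    is joined to the rest of [S] only through [v], and a smallest such [C] does
    what the subtree of a deepest vertex does ([hanging_piece]).

    Let [S] be the union of the two largest classes of an optimal colouring, so
    that [#|S| >= 2 n / chi].  Everything outside [S], together with a cover of
    the forest on [S], covers [G] with at most
    [n - #|S| + #|S| / k = n - #|S| (k - 1) / k] vertices ([psi_bound]).
    With a single colour there are no two classes, but then there is no edge
    and the empty set is a cover.

    The bound is attained for two colours by the path of order [k], which needs
    one vertex, and for [k = 2] by the complete graph on [c] vertices, which
    needs [c - 1].  Both graphs are chordal since they have an elimination
    ordering ([elimination_chordal]). *)

(** * Cycles in chordal graphs *)

Section Cycles.
Local Open Scope nat_scope.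
Variable G : sgraph.
Local Notation edgeG := (@edge G).

(** Cycles are sequences, and one or two vertices can be a [ucycle] of the edge
    relation, hence the bound 2. *)
Definition acyclic (S : {set G}) : Prop :=
  forall c : seq G, {subset c <= S} -> ucycle edgeG c -> size c <= 2.

Lemma nth_next (x0 : G) (c : seq G) i : uniq c -> i < size c ->
  next c (nth x0 c i) = nth x0 c (i.+1 %% size c).
Proof.
move=> uc lt_i; rewrite next_nth mem_nth //.
case: c uc lt_i => // y c uc lt_i; rewrite index_uniq //=.
rewrite /= ltnS leq_eqVlt in lt_i; case/orP: lt_i => [/eqP->|lt_i].
  by rewrite modnn nth_default.
by rewrite modn_small //=; apply: set_nth_default.
Qed.

(** The chord [xy] closes the arc of [c] from [x] to [y] into a cycle; since
    [x] and [y] are not consecutive on either side, both arcs have an inner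
    vertex, so the new cycle is shorter but still has three vertices. *)
Lemma cycle_chord (c : seq G) x y : ucycle edgeG c -> x \in c -> y \in c ->
  edge x y -> y != next c x -> x != next c y ->
  exists d : seq G, [/\ {subset d <= c}, ucycle edgeG d & 2 < size d < size c].
Proof.
case/andP=> cyc uc xc yc exy ny nx.
have [i s def_c] := rot_to xc.
have nE z : next c z = next (x :: s) z by rewrite -def_c next_rot.
have yxs : y \in x :: s by rewrite -def_c mem_rot.
have neq_yx : y != x by apply: contraTneq exy => ->; rewrite edge_irr.
have mem_c z : z \in x :: s -> z \in c by rewrite -def_c mem_rot.
have cyc' : cycle edgeG (x :: s) by rewrite -def_c rot_cycle.
have uxs : uniq (x :: s) by rewrite -def_c rot_uniq.
have -> : size c = size (x :: s) by rewrite -def_c size_rot.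
move: yxs ny nx; rewrite !nE inE (negPf neq_yx) /= => ys.
case/splitPr: ys mem_c cyc' uxs => p1 p2 mem_c cyc' uxs ny nx.
have ucd : ucycle edgeG (x :: rcons p1 y).
  move: cyc' uxs; rewrite /ucycle /= -cat_rcons rcons_cat cat_path.
  case/andP=> cyc' _; rewrite mem_cat cat_uniq negb_or.
  case/andP=> /andP[-> _] /andP[-> _].
  by rewrite rcons_path cyc' last_rcons edge_sym exy.
have p1n : p1 != [::] by apply: contraNneq ny => ->; rewrite /= eqxx.
have p2n : p2 != [::].
  apply: contraNneq nx => p2E; move: uxs; rewrite p2E => uxs.
  have := nth_next x (i := (size p1).+1) uxs.
  by rewrite /= nth_cat ltnn subnn /= size_cat /= addn1 modnn => ->.
exists (x :: rcons p1 y); split=> //.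
  move=> z; rewrite inE mem_rcons => zd; apply: mem_c.
  by rewrite inE mem_cat inE; move: zd; rewrite inE; case/or3P=> ->; rewrite ?orbT.
rewrite /= size_rcons size_cat /= addnS !ltnS.
case: p1 p1n {mem_c cyc' uxs ny nx ucd} => // a p1 _; case: p2 p2n => // b p2 _.
by rewrite /=; lia.
Qed.

(** A cycle with no chord and more than three vertices would be an induced
    cycle, so chords shorten any cycle down to a triangle. *)
Lemma chordal_triangle (c : seq G) :
  chordal G -> ucycle edgeG c -> 2 < size c ->
  exists x y z, [/\ x \in c, y \in c, z \in c & [&& edge x y, edge y z & edge x z]].
Proof.
move=> chG; have [n] := ubnP (size c); elim: n c => // n IHn c le_cn cyc lt2c.
have [le_c3|lt3c] := leqP (size c) 3.
  case: c cyc lt2c le_c3 {le_cn} => [|x [|y [|z []]]] //= cyc _ _.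
  exists x, y, z; rewrite !inE !eqxx !orbT; split=> //.
  case/andP: cyc => /= /and4P[-> -> ezx _] _.
  by rewrite /= edge_sym.
case: (pickP (fun xy : G * G => [&& xy.1 \in c, xy.2 \in c, edge xy.1 xy.2,
    xy.2 != next c xy.1 & xy.1 != next c xy.2])) => [[x y]|no_chord] /=.
  case/and5P=> xc yc exy ny nx.
  have [d [sdc cyd /andP[lt2d ltdc]]] := cycle_chord cyc xc yc exy ny nx.
  have [||//|u [v [w [ud vd wd tri]]]] := IHn d; first exact: leq_trans ltdc _.
    by [].
  by exists u, v, w; split; rewrite ?sdc.
(* Without chords, the enumeration of [c] is an induced cycle. *)
have x0 : G by case: (c) lt3c.
case/andP: cyc => cyc uc; case: (chG _ (fun i : 'I_(size c) => nth x0 c i) lt3c).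
have nextE (i : 'I_(size c)) j : j < size c ->
    (nth x0 c j == next c (nth x0 c i)) = (j == i.+1 %[mod size c]).
  move=> lt_j; rewrite nth_next // nth_uniq ?ltn_mod //; last by case: (size c) lt_j.
  by rewrite (modn_small lt_j).
split=> [i j /eqP|i j]; first by rewrite nth_uniq // => /eqP/val_inj.
rewrite /cycle_edge -!nextE //.
apply/idP/orP => [eij|[]/eqP->]; last 2 first.
- by apply: next_cycle; rewrite ?mem_nth.
- by rewrite edge_sym; apply: next_cycle; rewrite ?mem_nth.
apply/orP; have := no_chord (nth x0 c i, nth x0 c j).
by rewrite /= !mem_nth //= eij /= -negb_or => /negbFE.
Qed.

(** * Path covers of forests *)

Definition sub_edge (A : {set G}) : rel G :=
  [rel x y | [&& x \in A, y \in A & edge x y]].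

Lemma sub_edge_sym A : symmetric (sub_edge A).
Proof. by move=> x y; rewrite /sub_edge /= edge_sym andbCA. Qed.

(** Two neighbours of [v] joined by a path that avoids [v] would close a
    cycle through [v]. *)
Lemma acyclic_nbr (S D : {set G}) v x y :
  acyclic S -> v \in S -> D \subset S -> v \notin D -> x \in D ->
  connect (sub_edge D) x y -> edge v x -> edge v y -> x = y.
Proof.
move=> acS vS sDS vD xD /connectP[p0 p0_path ->].
case/shortenP: p0_path => p p_path up _ evx evy {p0}.
have pD : {subset x :: p <= D}.
  elim: p x xD p_path {up evx evy} => [|z p IHp] x xD /=.
    by move=> _ z; rewrite inE => /eqP->.
  case/andP=> /and3P[_ zD _] /(IHp _ zD) pD w.
  by rewrite inE => /predU1P[->|/pD].
have edge_path : path edgeG x p by apply: sub_path p_path => a b /and3P[].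
case: p up pD edge_path {p_path} evy => [//|z p] up pD edge_path evy.
have /acS : {subset v :: x :: z :: p <= S}.
  by move=> w; rewrite inE => /predU1P[->|/pD/(subsetP sDS)].
suff cyc : ucycle edgeG [:: v, x, z & p] by move/(_ cyc).
have vp : v \notin [:: x, z & p] by apply: contra vD => /pD.
rewrite /ucycle [uniq _]/= vp; move: up; rewrite /= => ->; rewrite andbT.
by move: edge_path evy; rewrite /= evx rcons_path (edge_sym v) => /andP[-> ->].
Qed.

Definition has_kpath k (A : {set G}) : bool :=
  [exists p : k.-tuple G, is_kpath p && all (mem A) p].

(** This plays the role of the subtree [C] at [v] in a rooted forest: only [v]
    may have neighbours in [S] outside [C]. *)
Definition hanging k (S : {set G}) v (C : {set G}) : Prop :=
  [/\ v \in C, C \subset S, has_kpath k C &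
    {in C :\ v & S, forall x y, edge x y -> y \in C}].

(** If [C] without [v] still contains a path of order [k], then the connected
    component of that path in [C] without [v] is a strictly smaller hanging
    piece: by acyclicity [v] has at most one neighbour [u] in this component,
    which therefore hangs at [u].  The descent starts from [S] itself, which
    hangs at any of its vertices. *)
Lemma hanging_piece k (S : {set G}) :
  0 < k -> acyclic S -> has_kpath k S ->
  exists v (C : {set G}), hanging k S v C /\ ~~ has_kpath k (C :\ v).
Proof.
move=> k_gt0 acS kS.
have [v0 v0S] : exists v0, v0 \in S.
  case/existsP: kS => -[[|v p] sz_p] /=; first by case: k k_gt0 sz_p.
  by case/and3P=> _ vS _; exists v.
suff: forall n v (C : {set G}), #|C| < n -> hanging k S v C ->
    exists v (C : {set G}), hanging k S v C /\ ~~ has_kpath k (C :\ v).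
  by move/(_ #|S|.+1 v0 S); apply=> //; split.
elim=> // n IHn v C le_Cn [vC sCS kC closedC].
have [kD|nkD] := boolP (has_kpath k (C :\ v)); last by exists v, C.
case/existsP: kD => -[[|x p] sz_p] /andP[]; rewrite /is_kpath /=.
  by case: k k_gt0 sz_p {kS kC IHn}.
case/andP=> up ep /andP[xD pD].
set D := C :\ v in closedC xD pD.
have vD : v \notin D by rewrite !inE eqxx.
have sDC : D \subset C by apply: subsetDl.
pose K := [set y | connect (sub_edge D) x y].
have xK : x \in K by rewrite inE connect0.
have sKD : K \subset D.
  apply/subsetP=> y; rewrite inE => /connectP[q].
  elim: q x xD {up ep pD K xK sz_p} => [|z q IHq] x xD /=; first by move=> _ ->.
  by case/andP=> /and3P[_ zD _] /(IHq _ zD).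
have sKC := subset_trans sKD sDC.
have kK : has_kpath k K.
  apply/existsP; exists (Tuple sz_p); rewrite /is_kpath /=.
  rewrite up ep xK /=; apply/allP=> y yp; rewrite /= inE.
  suff: path (sub_edge D) x p.
    by move/path_connect; apply; rewrite inE yp orbT.
  elim: p x xD ep pD {up sz_p K xK sKD sKC y yp} => //= z p IHp x xD.
  case/andP=> exz ep /andP[zD pD].
  by rewrite /sub_edge /= xD zD exz (IHp z zD ep pD).
(* If [v] has no neighbour in [K], any [u] in [K] will do. *)
have [u uK uP] : exists2 u, u \in K & forall y, y \in K -> edge v y -> y = u.
  case: (pickP [pred y in K | edge v y]) => [u /andP[uK evu]|no_nbr].
    exists u => // y yK evy; apply/esym.
    apply: (acyclic_nbr acS (subsetP sCS _ vC) _ vD) evu evy.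
    - exact: subset_trans sDC sCS.
    - exact: (subsetP sKD).
    move: uK yK; rewrite !inE => xu; apply: connect_trans.
    by rewrite (sym_connect_sym (@sub_edge_sym D)).
  by exists x => // y yK evy; have := no_nbr y; rewrite /= yK evy.
apply: (IHn u K).
  apply: leq_trans (_ : #|C| <= n) => //; apply: proper_card.
  by apply/properP; split=> //; exists v => //; apply: contra vD => /(subsetP sKD).
split=> //; first exact: subset_trans sKC sCS.
move=> z w /setD1P[zu zK] wS ezw.
have zD := subsetP sKD _ zK.
have wC := closedC _ _ zD wS ezw.
have [wv|wv] := eqVneq w v.
  by rewrite (uP z) ?eqxx // -?wv 1?edge_sym // in zu.
have wD : w \in D by rewrite !inE wv.
move: (zK); rewrite !inE => /connect_trans-> //.
by apply: connect1; rewrite /sub_edge /= zD wD.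
Qed.

(** Cutting at [v] separates [C] from the rest of [S], so a path avoiding [v]
    stays on one side; and [C] pays for [v] because it has at least [k]
    vertices. *)
Lemma acyclic_cover k (S : {set G}) : 0 < k -> acyclic S ->
  exists2 T : {set G}, k * #|T| <= #|S| & ~~ has_kpath k (S :\: T).
Proof.
move=> k_gt0; have [n] := ubnP #|S|; elim: n S => // n IHn S le_Sn acS.
have [kS|nkS] := boolP (has_kpath k S); last first.
  by exists set0; rewrite ?cards0 ?muln0 ?setD0.
have [v [C [[vC sCS kC closedC] nkC]]] := hanging_piece k_gt0 acS kS.
have lt_SC : #|S :\: C| < #|S|.
  apply: proper_card; apply/properP; split; first exact: subsetDl.
  by exists v; rewrite ?(subsetP sCS) // inE vC.
have [||T leT nkT] := IHn (S :\: C); first exact: leq_trans lt_SC _.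
  by move=> c cS; apply: acS => z /cS /setDP[].
exists (v |: T).
  have le_kC : k <= #|C|.
    case/existsP: kC => p /andP[/andP[up _] pC].
    rewrite -(size_tuple p) -(card_uniqP up); apply: subset_leq_card.
    by apply/subsetP=> z /(allP pC).
  have := cardsID C S; rewrite (setIidPr sCS) => <-.
  have := leq_add le_kC leT; apply: leq_trans.
  by rewrite -mulnS leq_mul2l cardsU1 -add1n leq_add2r leq_b1 orbT.
apply/existsP=> -[p /andP[kp pA]].
have [pC|pC] := boolP (all (mem (C :\ v)) p).
  by case/existsP: nkC; exists p; rewrite kp.
case/existsP: nkT; exists p; rewrite kp /=.
have closedD x y : x \in S :\: (v |: T) -> y \in S :\: (v |: T) -> edge x y ->
    (x \in C) = (y \in C).
  rewrite !inE !negb_or => /andP[/andP[xv _] xS] /andP[/andP[yv _] yS] exy.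
  apply/idP/idP=> zC; first by apply: (closedC x y) exy; rewrite ?inE ?xv.
  by apply: (closedC y x); rewrite ?inE ?yv 1?edge_sym.
have sameC x p' : path edgeG x p' -> all (mem (S :\: (v |: T))) (x :: p') ->
    all (fun y => (y \in C) == (x \in C)) p'.
  elim: p' x => //= y p' IHp x /andP[exy ep] /and3P[xA yA pA'].
  rewrite -(closedD _ _ xA yA exy) eqxx /=.
  by rewrite (closedD _ _ xA yA exy) IHp //= yA.
case: p kp pA pC => -[|x p] sz_p /andP[_ ep] //.
rewrite [tval _]/= => pA pC; have pC_x := sameC x p ep pA.
have sC y : y \in x :: p -> (y \in C) = (x \in C).
  by rewrite inE => /predU1P[->|/(allP pC_x)/eqP].
have xC : x \notin C.
  apply: contra pC => xC; apply/allP=> y yp; move: (allP pA y yp).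
  by rewrite /= !inE negb_or sC // xC andbT => /andP[/andP[]].
apply/allP=> y yp; move: (allP pA y yp).
by rewrite /= !inE negb_or sC // (negPf xC) /= => /andP[/andP[_ ->]].
Qed.

End Cycles.

(** * The upper bound *)

Section Bounds.
Local Open Scope nat_scope.

Lemma chi_coloring (G : sgraph) :
  exists f : G -> 'I_(chi G), forall x y, edge x y -> f x != f y.
Proof.
rewrite /chi; case: ex_minnP => c /existsP[f /forallP fP] _.
by exists f => x y exy; move/forallP: (fP x) => /(_ y)/implyP; apply.
Qed.

Lemma chi_le (G : sgraph) c (f : G -> 'I_c) :
  (forall x y, edge x y -> f x != f y) -> chi G <= c.
Proof.
move=> fP; rewrite /chi; case: ex_minnP => m _; apply; apply/existsP.
exists (finfun f); apply/forallP=> x; apply/forallP=> y; apply/implyP=> exy.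
by rewrite !ffunE fP.
Qed.

Lemma kpath_coverE k (G : sgraph) (T : {set G}) :
  kpath_cover k T = ~~ has_kpath k (~: T).
Proof.
rewrite /has_kpath negb_exists; apply: eq_forallb => p.
rewrite negb_and implybE; congr (_ || _).
apply/existsP/allPn => [[x /andP[xT xp]]|[x xp]]; first by exists x; rewrite //= inE xT.
by rewrite /= inE negbK => xT; exists x; rewrite xT.
Qed.

Lemma psiP k (G : sgraph) : 0 < k ->
  exists T : {set G}, [/\ kpath_cover k T, psi k G = #|T| &
    forall A : {set G}, kpath_cover k A -> psi k G <= #|A|].
Proof.
move=> k_gt0; rewrite /psi; case: arg_minnP => [|T covT minT]; last by exists T.
rewrite kpath_coverE setCT; apply/existsP=> -[[[|x p] sz_p] /=].
  by case: k k_gt0 sz_p.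
by rewrite inE andbF.
Qed.

(** The two largest of [c] classes together have at least twice the average
    size.  For two distinct classes to exist, [c] must exceed 1. *)
Lemma two_large_classes (T : finType) c (f : T -> 'I_c) : 1 < c ->
  exists i j, 2 * #|T| <= c * #|[set x | f x \in [:: i; j]]|.
Proof.
case: c f => [|[|c]] // f _.
pose a i := #|[set x | f x == i]|.
have [i _ maxi] := @arg_maxnP _ ord0 xpredT a isT.
have ne_i : lift i ord0 != i by rewrite eq_sym neq_lift.
have [j ji maxj] := @arg_maxnP _ (lift i ord0) (fun j => j != i) a ne_i.
exists i, j.
have -> : #|[set x | f x \in [:: i; j]]| = a i + a j.
  rewrite -cardsUI [X in _ + X](_ : _ = 0) ?addn0.
    by apply: eq_card => x; rewrite !inE.
  apply/eqP; rewrite cards_eq0 -subset0; apply/subsetP=> x; rewrite !inE.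
  by case/andP=> /eqP-> ij; rewrite eq_sym ij in ji.
have cardT : #|T| = \sum_k a k.
  rewrite -sum1_card (partition_big f xpredT) //=; apply: eq_bigr => k _.
  by rewrite sum1dep_card.
have : #|T| <= a i + c.+1 * a j.
  rewrite cardT (bigD1 i) //= leq_add2l.
  apply: (@leq_trans (\sum_(k < c.+2 | k != i) a j)); first exact: leq_sum.
  by rewrite sum_nat_const cardC1 card_ord.
(* It remains to use [(c - 2) * (a i - a j) >= 0] for the [c] of the lemma. *)
have := maxi j isT; nia.
Qed.

(** Three mutually adjacent vertices cannot share two colours. *)
Lemma bicolored_acyclic (G : sgraph) (C : eqType) (f : G -> C) i j :
  chordal G -> (forall x y : G, edge x y -> f x != f y) ->
  acyclic [set x : G | f x \in [:: i; j]].
Proof.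
move=> chG fP c cS cyc; rewrite leqNgt; apply/negP=> lt2c.
have [x [y [z [/cS xS /cS yS /cS zS]]]] := chordal_triangle chG cyc lt2c.
case/and3P=> /fP xy /fP yz /fP xz; move: xS yS zS xy yz xz; rewrite !inE.
by case/orP=> /eqP->; case/orP=> /eqP->; case/orP=> /eqP->; rewrite ?eqxx.
Qed.

(** This is the bound of the theorem multiplied by [chi G * k], which keeps it
    in the natural numbers. *)
Lemma psi_bound k (G : sgraph) : 0 < k -> 1 < chi G -> chordal G ->
  chi G * k * psi k G + 2 * k.-1 * #|G| <= chi G * k * #|G|.
Proof.
move=> k_gt0 c_gt1 chG.
have [f fP] := chi_coloring G.
have [i [j]] := two_large_classes f c_gt1; set S := [set x | _] => leS.
have acS : acyclic S by apply: bicolored_acyclic.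
have [T leT nkT] := acyclic_cover k_gt0 acS.
have [_ [_ _ /(_ (T :|: ~: S)) minT]] := psiP G k_gt0.
have {}minT : psi k G <= #|T| + #|~: S|.
  apply: leq_trans (leq_card_setU _ _); apply: minT.
  by rewrite kpath_coverE setCU setCK setIC -setDE.
have cardG : #|S| + #|~: S| = #|G| by apply: cardsC.
case: k {k_gt0 nkT} => [|m] /= in leT minT *; first by rewrite muln0.
move: leS leT minT cardG.
set s := #|S|; set n := #|_ G|; set t := #|T|; set c := chi G; set d := #|~: S|.
set q := psi _ _ => leS leT minT cardG.
have le1 : c * (m.+1 * q + m * s) <= c * (m.+1 * n).
  by rewrite leq_mul2l; apply/orP; right; nia.
have le2 : m * (2 * n) <= m * (c * s) by rewrite leq_mul2l leS orbT.
nia.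
Qed.

(** * Extremal graphs *)

Lemma cycle_edge_ordS m (i : 'I_m) : cycle_edge i (ordS i).
Proof. by rewrite /cycle_edge /= modn_mod eqxx. Qed.

Lemma cycle_edge_ordSS m (i : 'I_m) : 3 < m ->
  ordS (ordS i) != i /\ ~~ cycle_edge (ordS (ordS i)) i.
Proof.
move=> lt3m.
have modS (a : 'I_m) : a.+1 %% m = if a.+1 == m then 0 else a.+1.
  case: eqP => [->|/eqP ne]; first by rewrite modnn.
  by rewrite modn_small // ltn_neqAle ne ltn_ord.
have a_def : ordS i = _ :> nat := modS i.
have b_def : ordS (ordS i) = _ :> nat := modS (ordS i).
have lt_i := ltn_ord i.
rewrite -(inj_eq (@ord_inj m)) /cycle_edge.
rewrite !(modn_small (ltn_ord _)) !modS !b_def !a_def.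
clear modS a_def b_def.
by split; do ?[case: ifP => /eqP]; lia.
Qed.

(** The last vertex of an induced cycle in an elimination ordering would have
    its two neighbours on the cycle adjacent, a chord when the cycle has more
    than three vertices. *)
Lemma elimination_chordal (G : sgraph) (r : G -> nat) :
  (forall x y z : G, edge x y -> edge x z -> y != z -> r y <= r x -> r z <= r x ->
     edge y z) -> chordal G.
Proof.
move=> elimP [|m] // f lt3m [injf fE].
have [i _ maxi] := @arg_maxnP _ (ord0 : 'I_m.+1) xpredT (fun i => r (f i)) isT.
pose j := ord_pred i; have Dj : ordS j = i by apply: ord_predK.
have [ne ncyc] := cycle_edge_ordSS j lt3m; rewrite Dj in ne ncyc.
move/negP: ncyc; apply; rewrite -fE.
apply: (elimP (f i)); rewrite ?fE ?cycle_edge_ordS ?(inj_eq injf) ?maxi //; last 2 first.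
- exact: maxi.
- exact: maxi.
rewrite /cycle_edge orbC -/(cycle_edge j i) -[X in cycle_edge j X]Dj.
exact: cycle_edge_ordS.
Qed.

Definition complete_edge (c : nat) : rel 'I_c := [rel i j | i != j].

Lemma complete_sym c : symmetric (@complete_edge c).
Proof. by move=> i j; rewrite /complete_edge /= eq_sym. Qed.

Lemma complete_irr c : irreflexive (@complete_edge c).
Proof. by move=> i; rewrite /complete_edge /= eqxx. Qed.

Definition complete c := SGraph (@complete_sym c) (@complete_irr c).

Lemma chordal_complete c : chordal (complete c).
Proof. by apply: (@elimination_chordal _ (fun=> 0)) => x y z _ _ yz _ _. Qed.

Lemma chi_complete c : chi (complete c) = c.
Proof.
apply/eqP; rewrite eqn_leq (@chi_le (complete c) c id) //=.
have [f fP] := chi_coloring (complete c).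
rewrite -{1}(card_ord c) -[X in _ <= X]card_ord; apply: (@leq_card _ _ f).
by move=> x y; apply: contra_eq => /fP.
Qed.

(** Two vertices outside a cover would form a path of order 2. *)
Lemma psi_complete c : c.-1 <= psi 2 (complete c).
Proof.
have [T [covT -> _]] := psiP (complete c) (isT : 0 < 2).
have cardT := cardsC T; rewrite [RHS](card_ord c) in cardT.
suff: #|~: T| <= 1 by lia.
rewrite leqNgt; apply/card_gt1P=> -[x [y [xT yT xy]]].
move: covT; rewrite kpath_coverE; case/existsP; exists [tuple x; y].
rewrite !inE in xT yT.
by rewrite /is_kpath /= !inE /complete_edge /= xy xT yT.
Qed.

Definition path_edge (k : nat) : rel 'I_k :=
  [rel i j : 'I_k | (j == i.+1 :> nat) || (i == j.+1 :> nat)].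

Lemma path_edge_sym k : symmetric (@path_edge k).
Proof. by move=> i j; rewrite /path_edge /= orbC. Qed.

Lemma path_edge_irr k : irreflexive (@path_edge k).
Proof. by move=> i; rewrite /path_edge /=; lia. Qed.

Definition path_graph k := SGraph (@path_edge_sym k) (@path_edge_irr k).

Lemma chordal_path_graph k : chordal (path_graph k).
Proof.
apply: (@elimination_chordal (path_graph k) (@nat_of_ord k)) => x y z /=.
rewrite /path_edge -(inj_eq (@ord_inj k)) /=; lia.
Qed.

Lemma chi_path_graph k : 1 < k -> chi (path_graph k) = 2.
Proof.
case: k => [|[|k]] // _; apply/eqP; rewrite eqn_leq.
rewrite (@chi_le (path_graph k.+2) 2 (fun i => inord (odd i))) /=; last first.
  move=> i j; rewrite /path_edge -val_eqE /= !inordK ?ltnS ?leq_b1 //.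
  by case/orP=> /eqP-> /=; case: odd.
have [f fP] := chi_coloring (path_graph k.+2).
have ne := fP ord0 (lift ord0 ord0) isT.
case: (chi _) f ne {fP} => [|[|c]] f ne //; first by case: (f ord0).
by rewrite !ord1 eqxx in ne.
Qed.

Lemma psi_path_graph k : 0 < k -> 0 < psi k (path_graph k).
Proof.
move=> k_gt0; have [T [covT -> _]] := psiP (path_graph k) k_gt0.
rewrite lt0n cards_eq0; apply: contraL covT => /eqP->.
rewrite kpath_coverE negbK setC0.
have sz : size (enum 'I_k) == k by rewrite size_enum_ord.
apply/existsP; exists (Tuple sz); rewrite /is_kpath /= enum_uniq.
apply/andP; split; last by apply/allP=> x _; rewrite /= inE.
apply/(sortedP (Ordinal k_gt0)) => i; rewrite size_enum_ord => lt_i.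
by rewrite /path_edge /= !nth_enum_ord // ?eqxx // ltnW.
Qed.

End Bounds.

(** * The theorem *)

Lemma bound_rat (c k n q : nat) : (0 < c)%N -> (0 < k)%N ->
  (c * k * q + 2 * k.-1 * n <= c * k * n)%N =
  (q%:R <= (1 - 2 / c%:R * ((k%:R - 1) / k%:R)) * n%:R :> rat).
Proof.
move=> c_gt0 k_gt0; have ck_gt0 : 0 < c%:R * k%:R :> rat.
  by rewrite -natrM ltr0n muln_gt0 c_gt0.
have [c0 k0] : c%:R != 0 :> rat /\ k%:R != 0 :> rat.
  by rewrite !pnatr_eq0 -!lt0n.
rewrite -(ler_pM2l ck_gt0) -(ler_nat rat) natrD !natrM -subn1 natrB //.
rewrite -lerBrDr; congr (_ <= _); field.
by rewrite c0 k0.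
Qed.

Theorem theorem18 :
  [/\ forall (k : nat) (G : sgraph),
        (2 <= k)%N -> chordal G -> (chi G = 1%N -> k = 2%N) ->
        (psi k G)%:R
          <= (1 - 2 / (chi G)%:R * ((k%:R - 1) / k%:R)) * #|G|%:R :> rat,
      forall k : nat, (2 <= k)%N ->
        exists G : sgraph,
          [/\ chordal G, chi G = 2%N &
              (psi k G)%:R
                = (1 - 2 / 2%:R * ((k%:R - 1) / k%:R)) * #|G|%:R :> rat] &
      forall c : nat, (1 <= c)%N ->
        exists G : sgraph,
          [/\ chordal G, chi G = c &
              (psi 2 G)%:R
                = (1 - 2 / c%:R * ((2%:R - 1) / 2%:R)) * #|G|%:R :> rat]].
Proof.
have bound (k : nat) (G : sgraph) :
    (2 <= k)%N -> chordal G -> (chi G = 1%N -> k = 2%N) ->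
    (psi k G)%:R
      <= (1 - 2 / (chi G)%:R * ((k%:R - 1) / k%:R)) * #|G|%:R :> rat.
  move=> k_gt1 chG chi1.
  have [T [_ _ minT]] := psiP G (ltnW k_gt1).
  have [f fP] := chi_coloring G.
  have [c_gt1|] := ltnP 1 (chi G).
    by rewrite -bound_rat ?(ltnW k_gt1) ?(ltnW c_gt1) ?psi_bound ?(ltnW k_gt1).
  case: (chi G) f fP chi1 => [|[|//]] f fP chi1 _.
    have G0 : #|G| = 0%N by apply/eqP/pred0P=> x; case: (f x).
    have : (psi k G <= 0)%N by rewrite -G0; apply: max_card.
    by rewrite leqn0 G0 => /eqP->; rewrite mulr0.
  have -> : psi k G = 0%N.
    apply/eqP; rewrite -leqn0 -(cards0 G); apply: minT; rewrite chi1 //.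
    apply/forallP=> -[[|x [|y []]] //= sz]; rewrite /is_kpath /= andbT.
    apply/implyP=> /andP[_ /andP[exy _]].
    by have := fP _ _ exy; rewrite !ord1 eqxx.
  rewrite chi1 // (_ : 1 - _ = 0) ?mul0r //; field.
split=> // [k k_gt1|c c_gt0].
  have chiP := chi_path_graph k_gt1; have k_gt0 := ltnW k_gt1.
  exists (path_graph k); split; [exact: chordal_path_graph|exact: chiP|].
  have chi1 : chi (path_graph k) = 1%N -> k = 2%N by rewrite chiP.
  have := bound k _ k_gt1 (@chordal_path_graph k) chi1; rewrite chiP.
  have -> : (1 - 2 / 2%:R * ((k%:R - 1) / k%:R)) * #|path_graph k|%:R = 1 :> rat.
    by rewrite /= card_ord; field; rewrite pnatr_eq0 -lt0n.
  by move=> ub; apply/eqP; rewrite eq_le ub ler1n psi_path_graph.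
have chiK := chi_complete c.
exists (complete c); split; [exact: chordal_complete|exact: chiK|].
have := bound 2%N _ isT (@chordal_complete c) (fun=> erefl); rewrite chiK.
have -> : (1 - 2 / c%:R * ((2%:R - 1) / 2%:R)) * #|complete c|%:R = c.-1%:R :> rat.
  by rewrite /= card_ord -subn1 natrB //; field; rewrite pnatr_eq0 -lt0n.
by move=> ub; apply/eqP; rewrite eq_le ub ler_nat psi_complete.
Qed.
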